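(* The Følner function of $\mathrm{Sym}(\mathbb Z)\rtimes\mathbb Z$ is asymptotically equivalent to $n^n$. More generally, for every integer $d\ge1$, the Følner function of $\mathrm{Sym}(\mathbb Z^d)\rtimes\mathbb Z^d$ (or of $\mathrm{Sym}(N)\rtimes N$, for any finitely generated group $N$ of growth $v_N(n)\simeq n^d$) is asymptotically equivalent to $n^{n^d}$.
   Context: For a finitely generated group $H$, $\mathrm{Sym}(H)$ is the group of permutations of the set $H$ with finite support, and $\mathrm{Sym}(H)\rtimes H$ is its extension by $H$, where $H$ acts via translation of the underlying set $H$; it is finitely generated. $v_H(n)$ is the number of elements of $H$ of word length $\le n$. For a group $G$ with finite symmetric generating set $S$ and word metric $d_S$, $\partial_S V$ is the set of $v\in V$ at $d_S$-distance one from $G\setminus V$, and the Følner function $\mathrm{F\o l}_{G,S}(n)$ is the minimum of $\#V$ over finite non-empty $V\subset G$ with $\#\partial_SV/\#V\le1/n$. For functions, $f_1\preceq f_2$ means there are positive constants $C,K$ with $f_1(x)\le Cf_2(Kx)$ for all $x$; $f_1\simeq f_2$ (asymptotically equivalent) means $f_1\preceq f_2$ and $f_2\preceq f_1$. The $\simeq$-class of the Følner function does not depend on the generating set. *)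

(* Defs.v *)
From HB Require Import structures.
From mathcomp Require Import all_boot all_order all_algebra.
From mathcomp Require Import finmap.
From mathcomp Require Import boolp classical_sets functions cardinality.

Set Implicit Arguments.
Unset Strict Implicit.
Unset Printing Implicit Defensive.

Import Order.TTheory GRing.Theory Num.Theory.

Local Open Scope classical_set_scope.
Local Open Scope fset_scope.
Local Open Scope group_scope.

(* The inverse is bundled as data, but it is determined by the function. *)
Record fsperm (H : Type) := FSPerm {
  fsperm_fun :> H -> H;
  fsperm_inv : H -> H;
  fsperm_funK : cancel fsperm_fun fsperm_inv;
  fsperm_invK : cancel fsperm_inv fsperm_fun;
  fsperm_finite_support : finite_set [set x | fsperm_fun x <> x]
}.

HB.instance Definition _ (H : Type) := gen_eqMixin (fsperm H).
HB.instance Definition _ (H : Type) := gen_choiceMixin (fsperm H).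

Section FSPermGroup.
Variable H : Type.
Implicit Types s t u : fsperm H.

Lemma fspermP s t : s =1 t -> s = t.
Proof.
case: s t => [f f' fK f'K ff] [g g' gK g'K gf] /= /funext fg.
subst g.
have fg' : f' = g' by apply: funext => x; rewrite -[x in LHS]g'K fK.
subst g'.
by rewrite (Prop_irrelevance fK gK) (Prop_irrelevance f'K g'K)
  (Prop_irrelevance ff gf).
Qed.

Lemma fsperm1_finite : finite_set [set x : H | idfun x <> x].
Proof. by apply: (@sub_finite_set _ _ set0). Qed.

Definition fsperm1 : fsperm H :=
  @FSPerm H idfun idfun (fun=> erefl) (fun=> erefl) fsperm1_finite.

Lemma fspermM_finite s t : finite_set [set x | (s \o t) x <> x].
Proof.
apply: (@sub_finite_set _ _ ([set x | s x <> x] `|` [set x | t x <> x])).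
  move=> x /= stx; have [tx|] := pselect (t x = x); last by right.
  by left; rewrite tx in stx.
by rewrite finite_setU; split; exact: fsperm_finite_support.
Qed.

(* Permutations are composed as functions: (s t)(x) = s(t(x)). *)
Definition fspermM s t : fsperm H :=
  FSPerm (can_comp (@fsperm_funK H s) (@fsperm_funK H t))
    (can_comp (@fsperm_invK H t) (@fsperm_invK H s)) (fspermM_finite s t).

Lemma fspermV_finite s : finite_set [set x | fsperm_inv s x <> x].
Proof.
apply: sub_finite_set (@fsperm_finite_support H s) => x /= sx sxx; apply: sx.
by rewrite -[x in LHS]sxx fsperm_funK.
Qed.

Definition fspermV s : fsperm H :=
  FSPerm (@fsperm_invK H s) (@fsperm_funK H s) (fspermV_finite s).

Lemma fspermMA : associative fspermM.
Proof. by move=> s t u; apply: fspermP. Qed.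

Lemma fsperm1M : left_id fsperm1 fspermM.
Proof. by move=> s; apply: fspermP. Qed.

Lemma fspermM1 : right_id fsperm1 fspermM.
Proof. by move=> s; apply: fspermP. Qed.

Lemma fspermVM : left_inverse fsperm1 fspermV fspermM.
Proof. by move=> s; apply: fspermP => x /=; rewrite fsperm_funK. Qed.

Lemma fspermMV : right_inverse fsperm1 fspermV fspermM.
Proof. by move=> s; apply: fspermP => x /=; rewrite fsperm_invK. Qed.

HB.instance Definition _ :=
  isGroup.Build (fsperm H) fspermMA fsperm1M fspermM1 fspermVM fspermMV.

End FSPermGroup.

Section Translation.
Variable H : groupType.
Implicit Types (g h : H) (s t : fsperm H).

Definition translate_fun g (f : H -> H) (x : H) : H := g * f (g^-1 * x).

Lemma translate_funK g (f f' : H -> H) :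
  cancel f f' -> cancel (translate_fun g f) (translate_fun g f').
Proof. by move=> fK x; rewrite /translate_fun mulKg fK mulVKg. Qed.

Lemma translate_finite g s : finite_set [set x | translate_fun g s x <> x].
Proof.
apply: (@sub_finite_set _ _ [set g * x | x in [set x | s x <> x]]).
  move=> x /= sx; exists (g^-1 * x); last by rewrite mulVKg.
  by move=> e; apply: sx; rewrite /translate_fun e mulVKg.
exact/finite_image/fsperm_finite_support.
Qed.

(* The action of g on Sym(H) induced by the left translation x |-> g x. *)
Definition translate g s : fsperm H :=
  FSPerm (translate_funK g (@fsperm_funK H s))
    (translate_funK g (@fsperm_invK H s)) (translate_finite g s).

Lemma translate1 s : translate 1 s = s.
Proof.
by apply: fspermP => x; rewrite /= /translate_fun invg1 !mul1g.
Qed.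

Lemma translateM g h s : translate (g * h) s = translate g (translate h s).
Proof.
by apply: fspermP => x; rewrite /= /translate_fun invgM !mulgA.
Qed.

Lemma translate_mul g s t : translate g (s * t) = translate g s * translate g t.
Proof. by apply: fspermP => x; rewrite /= /translate_fun mulKg. Qed.

Lemma translate_one g : translate g 1 = 1.
Proof. by apply: fspermP => x; rewrite /= /translate_fun mulVKg. Qed.

End Translation.

(* A record rather than a product type, on which the direct product is the
   canonical group structure. *)
Record symext (H : Type) := SymExt { symext_perm : fsperm H; symext_elt : H }.

HB.instance Definition _ (H : Type) := gen_eqMixin (symext H).
HB.instance Definition _ (H : Type) := gen_choiceMixin (symext H).

Section SymExtGroup.
Variable H : groupType.
Implicit Types a b c : symext H.

Definition symext1 : symext H := SymExt 1 1.

Definition symextM a b : symext H :=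
  SymExt (symext_perm a * translate (symext_elt a) (symext_perm b))
    (symext_elt a * symext_elt b).

Definition symextV a : symext H :=
  SymExt (translate (symext_elt a)^-1 (symext_perm a)^-1) (symext_elt a)^-1.

Lemma symextMA : associative symextM.
Proof.
by move=> [s g] [t h] [u k]; rewrite /symextM /= translate_mul translateM !mulgA.
Qed.

Lemma symext1M : left_id symext1 symextM.
Proof. by move=> [s g]; rewrite /symextM /= translate1 !mul1g. Qed.

Lemma symextM1 : right_id symext1 symextM.
Proof. by move=> [s g]; rewrite /symextM /= translate_one !mulg1. Qed.

Lemma symextVM : left_inverse symext1 symextV symextM.
Proof.
by move=> [s g]; rewrite /symextM /symextV /= -translate_mul !mulVg translate_one.
Qed.

Lemma symextMV : right_inverse symext1 symextV symextM.
Proof.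
by move=> [s g]; rewrite /symextM /symextV /= -translateM !mulgV translate1 mulgV.
Qed.

HB.instance Definition _ :=
  isGroup.Build (symext H) symextMA symext1M symextM1 symextVM symextMV.

End SymExtGroup.

Section WordMetric.
Variables (G : groupType) (S : {fset G}).

Definition represents (w : seq G) (g : G) : Prop :=
  {subset w <= S} /\ \prod_(s <- w) s = g.

Definition symmetric_generating : Prop :=
  (forall s, s \in S -> s^-1 \in S) /\ (forall g, exists w, represents w g).

(* On a nonempty set of natural numbers, infimum is the minimum. *)
Definition word_length (g : G) : nat :=
  infimum 0%N [set size w | w in [set w | represents w g]].

(* The left-invariant word metric: the Cayley graph has edges x -- x * s. *)
Definition word_dist (x y : G) : nat := word_length (x^-1 * y).

Definition growth (n : nat) : nat :=
  #|` fset_set [set g | (word_length g <= n)%N]|.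

Definition boundary (V : {fset G}) : {fset G} :=
  [fset v in V | `[< exists2 w, w \notin V & word_dist v w = 1%N >]].

Definition folner_set (n : nat) (V : {fset G}) : Prop :=
  V != fset0 /\ (#|` boundary V|%:R / #|` V|%:R <= 1 / n%:R :> rat)%R.

(* The default value 0, which is not the cardinal of a nonempty set, is taken
   exactly when there is no such set, i.e. when the minimum is infinite. *)
Definition folner (n : nat) : nat :=
  infimum 0%N [set #|` V| | V in folner_set n].

End WordMetric.

(* The constants are positive integers so that K * x is again an argument. The
   argument 0 is left out, as Fol(0) is not defined. *)
Definition asymp_le (f1 f2 : nat -> nat) : Prop :=
  exists C K : nat, [/\ (0 < C)%N, (0 < K)%N &
    forall x : nat, (0 < x)%N -> (f1 x <= C * f2 (K * x))%N].

Definition asymp_equiv (f1 f2 : nat -> nat) : Prop :=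
  asymp_le f1 f2 /\ asymp_le f2 f1.

(* The first conjunct keeps the second one from being vacuous. *)
Definition folner_asymp (G : groupType) (f : nat -> nat) : Prop :=
  (exists S : {fset G}, symmetric_generating S) /\
  (forall S : {fset G}, symmetric_generating S -> asymp_equiv (folner S) f).

(* Main.v *)
Require Import Defs.
From HB Require Import structures.
From mathcomp Require Import all_boot all_order all_algebra.
From mathcomp Require Import finmap.
From mathcomp Require Import boolp classical_sets functions cardinality.
From mathcomp Require Import zify.

(** Write [G] for the extension of the group [Sym(N)] of finitely supported
permutations by [N], and [v] for the growth function of [N], of order [n ^ d].
The group [G] acts on the set [N] by [(s, g) . x = s (g x)].

Upper bound.  Since [v] is polynomial, some ball [F] of [N] with radius of order
[n] loses only one [n]-th of its elements when its radius is decreased by a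
given constant ([slow_radius]).  Fix a finite [A] containing the supports of
the generators of [G].  The pairs [(s, g)] with [g] in [F] and [s] supported in
[F A] form a set whose boundary only involves the outer layer of [F], so that it
is a Foelner set; it has at most [v r * (a * v r) ^ (a * v r)] elements, where
[r] is the radius of [F] and [a] bounds the size of [A] ([folner_upper]).

Lower bound.  For [b], [c] in the ball [B] of radius [n] of [N], the
transposition [(b c)] has length [O(n)] in [G] ([short_symswap]).  If the
boundary ratio of [V] is at most a small multiple of [1 / n], most pairs of a
point of [V] and such a transposition therefore stay in [V].  Deleting points
of low degree leaves a nonempty subset [Y] of [V] each of whose points stays in
[Y] under at least a quarter of all pairs [(b, c)] ([swap_degree_dense]).  Such
a [Y] is huge: at a point [w], some [b] admits [q] values [c] with [w (b c)] in
[Y]; these elements send [b] to the [q] distinct points [w . c], so they lie in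
[q] distinct fibres of [x |-> x . b], and each fibre has the same property, with
slightly smaller degrees, for [B] without [b].  Iterating gives [q ^ k] points,
with [q] and [k] of the order of [v n] ([swap_degree_card]). *)

Set Implicit Arguments.
Unset Strict Implicit.
Unset Printing Implicit Defensive.

Import Order.TTheory GRing.Theory Num.Theory.

Local Open Scope classical_set_scope.
Local Open Scope fset_scope.
Local Open Scope nat_scope.

(** * Counting in finite sets *)

Lemma sum_const_seq (I : Type) (s : seq I) (k : nat) :
  \sum_(i <- s) k = size s * k.
Proof. by rewrite big_const_seq count_predT iter_addn_0 mulnC. Qed.

Lemma sum_leq_size (I : eqType) (s : seq I) (F : I -> nat) k :
  (forall i, i \in s -> F i <= k) -> \sum_(i <- s) F i <= size s * k.
Proof.
move=> Fk; rewrite -sum_const_seq big_seq [X in _ <= X]big_seq.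
exact: leq_sum.
Qed.

Lemma sum_bool_size (I : Type) (s : seq I) (P : pred I) :
  \sum_(i <- s) P i = size [seq i <- s | P i].
Proof. by rewrite size_filter -sum1_count [RHS]big_mkcond /=; apply: eq_bigr => i _; case: (P i). Qed.

Lemma cardfs_sum (K : choiceType) (A : {fset K}) (P : pred K) :
  #|` [fset x in A | P x]| = \sum_(x <- A) P x.
Proof.
rewrite sum_bool_size; apply: perm_size; apply: uniq_perm.
- exact: fset_uniq.
- by apply: filter_uniq; apply: fset_uniq.
by move=> x; rewrite !inE mem_filter andbC.
Qed.

Lemma leq_cardfs_inj (K L : choiceType) (f : K -> L) (A : {fset K}) (B : {fset L}) :
  injective f -> (forall x, x \in A -> f x \in B) -> #|` A| <= #|` B|.
Proof.
move=> fi fAB; have <- : #|` f @` A| = #|` A| by rewrite card_imfset.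
by apply: fsubset_leq_card; apply/fsubsetP => y /imfsetP[x /= /fAB fx ->].
Qed.

Lemma sum_eq_le1 (I : eqType) (K : eqType) (s : seq I) (f : I -> K) (y : K) :
  uniq s -> {in s &, injective f} -> \sum_(i <- s) (y == f i) <= 1.
Proof.
move=> us fi; have -> : \sum_(i <- s) (y == f i) = count_mem y [seq f i | i <- s].
  by rewrite count_map -sum1_count [RHS]big_mkcond; apply: eq_bigr => i _; rewrite /= eq_sym; case: eqP.
rewrite count_uniq_mem ?leq_b1 //.
by rewrite map_inj_in_uniq.
Qed.

(** * Sets that are dense for the transpositions *)

Section DenseSets.
Variables (G : groupType) (N : choiceType) (act : G -> N -> N).
Variable (t : N -> N -> G).
Hypothesis actM : forall g h x, act (g * h)%g x = act g (act h x).
Hypothesis act_inj : forall g, injective (act g).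
Hypothesis tV : forall b c, (t b c * t b c = 1)%g.
Hypothesis act_t : forall b c, act (t b c) b = c.
Hypothesis act_tn : forall b c x, x != b -> x != c -> act (t b c) x = x.

(** The pairs are ordered and [b = c] is allowed, which affects only constants
and avoids all side conditions. *)
Definition swap_degree (X : {fset G}) (B : seq N) (v : G) : nat :=
  \sum_(b <- B) \sum_(c <- B) ((v * t b c)%g \in X).

(** A deleted point [v] costs its own degree, and as much again for the
neighbours that lose [v], because the [t b c] are involutions. *)
Lemma swap_degree_delete (X : {fset G}) (B : seq N) (v : G) : v \in X ->
  \sum_(w <- X) swap_degree X B w <=
    2 * swap_degree X B v + \sum_(w <- X `\ v) swap_degree (X `\ v) B w.
Proof.
move=> vX; rewrite (big_fsetD1 v) //= mul2n -addnn -addnA leq_add2l.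
have -> : \sum_(w <- X `\ v) swap_degree X B w =
  \sum_(w <- X `\ v) \sum_(b <- B) \sum_(c <- B) ((w * t b c)%g == v) +
  \sum_(w <- X `\ v) swap_degree (X `\ v) B w.
  rewrite -big_split /=; apply: eq_bigr => w _; rewrite -big_split /=.
  apply: eq_bigr => b _; rewrite -big_split /=; apply: eq_bigr => c _.
  by rewrite !inE; case: eqP => [->|]; rewrite ?vX.
rewrite leq_add2r exchange_big /=; apply: leq_sum => b _.
rewrite exchange_big /=; apply: leq_sum => c _.
rewrite (eq_bigr (fun w => (((v * t b c)%g == id w)%g : nat))); last first.
  move=> w _; congr nat_of_bool; apply/eqP/eqP => [<-|<-] /=.
    by rewrite -mulgA tV mulg1.
  by rewrite -mulgA tV mulg1.
case: (boolP ((v * t b c)%g \in X)) => vtX.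
  by apply: sum_eq_le1; rewrite ?fset_uniq // => ? ?.
rewrite big_seq big1 // => w; rewrite !inE => /andP[_ wX]; case: eqP => //= e.
by rewrite e wX in vtX.
Qed.

(** Deleting a point of degree at most [D / 2] lowers the total degree by at most
[D], so it preserves an average degree greater than [D]; when no such point
remains, the set is as wanted.  It cannot become empty, since its total degree
stays positive. *)
Lemma swap_degree_dense (D : nat) (B : seq N) (X : {fset G}) :
  D * #|` X| < \sum_(v <- X) swap_degree X B v ->
  exists Y : {fset G}, [/\ (Y `<=` X)%fset, Y != fset0 &
    forall v, v \in Y -> D < 2 * swap_degree Y B v].
Proof.
have [n] := ubnP #|` X|; elim: n X => // n IHn X Xn DX.
have [/existsP[v Dv]|] := boolP [exists v : X, 2 * swap_degree X B (fsval v) <= D].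
  have vX : fsval v \in X by [].
  have cX := cardfsD1 (fsval v) X; rewrite vX in cX.
  have [||Y [YX Y0 YD]] := IHn (X `\ fsval v).
  - lia.
  - have := swap_degree_delete B vX; rewrite cX mulnDr muln1 in DX; lia.
  exists Y; split=> //; exact: fsubset_trans YX (fsubD1set _ _).
rewrite negb_exists => /forallP DX'; exists X; split => //.
  apply: contraTneq DX => ->; by rewrite big_seq_fset0 cardfs0 muln0.
by move=> v vX; have := DX' [` vX]; rewrite -ltnNge.
Qed.

(** A transposition of two points other than [b] preserves the fibre over
[act v b], and at most [2 * size B] of the pairs involve [b]. *)
Lemma swap_degree_fiber (X : {fset G}) (B : seq N) (b y : N) (v : G) :
  b \in B -> uniq B -> act v b = y ->
  swap_degree X B v <=
    swap_degree [fset w in X | act w b == y] (rem b B) v + 2 * size B.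
Proof.
move=> bB uB vb; rewrite /swap_degree (perm_big _ (perm_to_rem bB)) big_cons /=.
have le1 (s : seq N) (P : pred N) : \sum_(c <- s) P c <= size s.
  by rewrite sum_bool_size size_filter count_size.
have sB : size (rem b B) <= size B by rewrite size_rem // leq_pred.
rewrite mul2n -addnn addnCA leq_add ?le1 //.
rewrite (eq_bigr (fun d => ((v * t d b)%g \in X) +
   \sum_(c <- rem b B) ((v * t d c)%g \in X))); last first.
  by move=> d _; rewrite (perm_big _ (perm_to_rem bB)) big_cons.
rewrite big_split /= addnC leq_add //; last exact: leq_trans (le1 _ _) _.
rewrite big_seq [X in _ <= X]big_seq; apply: leq_sum => d.
rewrite mem_rem_uniq // inE => /andP[db _].
rewrite big_seq [X in _ <= X]big_seq; apply: leq_sum => c.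
rewrite mem_rem_uniq // inE => /andP[cb _].
by rewrite !inE actM act_tn 1?eq_sym // vb eqxx andbT.
Qed.

(** By induction on [k]: by pigeonhole some [b] has at least [q] values [c] with
[w * t b c] in [W].  The fibres of [x |-> act x b] over the [act w c] are
disjoint and nonempty, and removing [b] from [B] costs degree [2 * m], which the
hypothesis on the degree allows [k] times. *)
Lemma swap_degree_card (q k m : nat) (W : {fset G}) (B : seq N) :
  0 < m -> uniq B -> size B <= m -> W != fset0 ->
  (forall w, w \in W -> m * (q + 2 * k) <= swap_degree W B w) ->
  q ^ k <= #|` W|.
Proof.
move=> m0; elim: k W B => [|k IHk] W B uB Bm W0 WD; first by rewrite expn0 cardfs_gt0.
have [w wW] : exists w, w \in W by apply/fset0Pn.
have [b bB qb] : exists2 b, b \in B & q <= \sum_(c <- B) ((w * t b c)%g \in W).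
  apply/hasP; apply/negPn/negP => /hasPn qB; have := WD w wW.
  rewrite leqNgt => /negP; apply.
  apply: (@leq_ltn_trans (size B * q)); last by nia.
  by apply: sum_leq_size => b /qB; rewrite -ltnNge => /ltnW.
rewrite sum_bool_size in qb.
set C := filter _ B in qb.
pose F c := [fset v in W | act v b == act w c].
have CW c : c \in C -> q ^ k <= #|` F c|.
  rewrite mem_filter => /andP[wc cB]; apply: (IHk _ (rem b B)).
  - exact: rem_uniq.
  - by rewrite size_rem // (leq_trans (leq_pred _)).
  - by apply/fset0Pn; exists (w * t b c)%g; rewrite !inE wc actM act_t /=.
  move=> v; rewrite !inE => /andP[/WD WDv /eqP vb].
  have := swap_degree_fiber W bB uB vb; rewrite -/(F c).
  by nia.
have disj : \sum_(c <- C) #|` F c| <= #|` W|.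
  under eq_bigr do rewrite cardfs_sum.
  rewrite exchange_big /= -[X in _ <= X]muln1.
  apply: sum_leq_size => v _; apply: sum_eq_le1; first exact: filter_uniq.
  by move=> ? ? _ _; apply: act_inj.
apply: leq_trans disj; rewrite expnS.
apply: (@leq_trans (\sum_(c <- C) q ^ k)).
  by rewrite sum_const_seq leq_mul2r qb orbT.
by rewrite big_seq [X in _ <= X]big_seq; apply: leq_sum.
Qed.

End DenseSets.

(** * Words, balls and boundaries *)

Lemma infimum_nat_min (A : set nat) (n : nat) : A n ->
  A (infimum 0 A) /\ (forall k, A k -> infimum 0 A <= k).
Proof.
move=> An; have exA : exists k, `[< A k >] by exists n; apply/asboolP.
case: (ex_minnP exA) => m /asboolP Am mlb.
suff -> : infimum 0 A = m by split=> // k Ak; apply: mlb; apply/asboolP.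
rewrite /infimum; case: eqP => [A0|_]; first by rewrite A0 in Am.
have mA : infimums A m.
  split=> [k Ak|k klb]; last by have := klb _ Am; rewrite leEnat.
  by rewrite leEnat; apply: mlb; apply/asboolP.
case: xgetP => [_ -> xA|/(_ m)//]; exact: (is_subset1_infimums xA mA).
Qed.

Section Words.
Variables (G : groupType) (S : {fset G}).
Implicit Types g h : G.

(** Bounds on lengths are stated through words, which concatenate, rather than
through the infimum [word_length]. *)
Definition short k g := exists2 w, represents S w g & size w <= k.

Lemma short1 k : short k 1%g.
Proof. by exists [::] => //; split=> //; rewrite big_nil. Qed.

Lemma short_gen g : g \in S -> short 1 g.
Proof.
move=> gS; exists [:: g] => //; split; last by rewrite big_seq1.
by move=> h; rewrite inE => /eqP->.
Qed.

Lemma shortM k l g h : short k g -> short l h -> short (k + l) (g * h)%g.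
Proof.
move=> [w [wS <-] wk] [z [zS <-] zl]; exists (w ++ z); last by rewrite size_cat leq_add.
by split; [move=> x; rewrite mem_cat => /orP[/wS|/zS] | rewrite big_cat].
Qed.

Lemma shortV k g : {in S, forall s, (s^-1)%g \in S} -> short k g -> short k g^-1%g.
Proof.
move=> symS [w [wS <-] wk]; elim: w k wS wk => [|s w IHw] [|k] wS wk //.
- by rewrite big_nil invg1; apply: short1.
- by rewrite big_nil invg1; apply: short1.
rewrite big_cons invgM -addn1; apply: shortM; last first.
  by apply: short_gen; apply: symS; apply: wS; rewrite inE eqxx.
by apply: IHw => // x xw; apply: wS; rewrite inE xw orbT.
Qed.

Lemma short_leq k l g : k <= l -> short k g -> short l g.
Proof. by move=> kl [w gw wk]; exists w => //; apply: leq_trans kl. Qed.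

Lemma shortS k g : short k.+1 g -> g = 1%g \/
  exists s h, [/\ s \in S, short k h & g = (s * h)%g].
Proof.
move=> [[|s w] [wS <-] wk]; first by left; rewrite big_nil.
right; exists s, (\prod_(x <- w) x)%g; split; last by rewrite big_cons.
- by apply: wS; rewrite inE eqxx.
by exists w => //; split=> // x xw; apply: wS; rewrite inE xw orbT.
Qed.

Hypothesis genS : symmetric_generating S.

Lemma short_ex g : exists k, short k g.
Proof. by have [w gw] := genS.2 g; exists (size w), w. Qed.

Lemma short_ex_seq (s : seq G) : exists k, forall g, g \in s -> short k g.
Proof.
elim: s => [|g s [k IHs]]; first by exists 0.
have [l gl] := short_ex g; exists (k + l) => h; rewrite inE => /orP[/eqP->|/IHs].
  exact: short_leq (leq_addl _ _) gl.
exact: short_leq (leq_addr _ _).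
Qed.

Lemma word_length_leq k g : (word_length S g <= k) <-> short k g.
Proof.
have [w0 gw0] := genS.2 g.
have gA : [set size w | w in [set w | represents S w g]] (size w0).
  by exists w0.
have [] := infimum_nat_min gA; rewrite -/(word_length S g) => -[w gw <-] wmin.
split=> [wk|[z gz zk]].
  by exists w.
by apply: leq_trans zk; apply: wmin; exists z.
Qed.

Lemma finite_short k : finite_set [set g | short k g].
Proof.
elim: k => [|k IHk].
  apply: (@sub_finite_set _ _ [set 1%g]); last exact: finite_set1.
  by move=> g [[|//] [_ <-] _] /=; rewrite big_nil.
apply: (@sub_finite_set _ _ ([set 1%g] `|`
   [set (s * h)%g | s in [set` S] & h in [set h | short k h]])%classic).
  move=> g /shortS[->|[s [h [sS hk ->]]]]; first by left.
  by right; exists s => //; exists h.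
rewrite finite_setU; split; first exact: finite_set1.
exact: finite_image2 (finite_fset _) IHk.
Qed.

Definition word_ball k : {fset G} := fset_set [set g | word_length S g <= k].

Lemma word_ballP k g : reflect (short k g) (g \in word_ball k).
Proof.
have bE : [set g | word_length S g <= k] = [set g | short k g].
  by apply/seteqP; split=> h /= /word_length_leq.
apply: (iffP idP); rewrite /word_ball bE in_fset_set ?inE //; exact: finite_short.
Qed.

Lemma growthE k : growth S k = #|` word_ball k|.
Proof. by []. Qed.

Lemma growth_leq k l : k <= l -> growth S k <= growth S l.
Proof.
move=> kl; rewrite !growthE; apply: fsubset_leq_card; apply/fsubsetP => g.
by move=> /word_ballP/(short_leq kl) ?; apply/word_ballP.
Qed.

Lemma boundaryP (V : {fset G}) v :
  reflect (v \in V /\ exists2 s, s \in S & (v * s)%g \notin V)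
    (v \in boundary S V).
Proof.
rewrite !inE; apply: (iffP andP) => -[vV].
  move=> /asboolP[w wV vw]; split=> //.
  have /shortS[] : short 1 (v^-1 * w)%g.
  - by apply/word_length_leq; rewrite -/(word_dist S v w) vw.
  - by move=> /(canRL (mulVKg _)); rewrite mulg1 => wv; rewrite wv vV in wV.
  move=> [s [h [sS [z [_ <-]]]]]; rewrite leqn0 size_eq0 => /eqP->.
  rewrite big_nil mulg1 => e; exists s => //; by rewrite -e mulVKg.
move=> [s sS vsV]; split=> //; apply/asboolP; exists (v * s)%g => //.
rewrite /word_dist mulKg; apply/eqP; rewrite eqn_leq; apply/andP; split.
  by apply/word_length_leq; apply: short_gen.
rewrite lt0n; apply: contraNneq vsV => s0.
have /word_length_leq[z [_ <-]] : word_length S s <= 0 by rewrite s0.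
by rewrite leqn0 size_eq0 => /eqP->; rewrite big_nil mulg1.
Qed.

(** Along a word [s_1 .. s_k], each point of [V] that leaves [V] does so at some
step [i], and it is then at a boundary point; right translation by the first
letters is injective, so each step accounts for at most one exit per boundary
point. *)
Lemma leak_leq (V : {fset G}) k u : short k u ->
  \sum_(v <- V) ((v * u)%g \notin V) <= k * #|` boundary S V|.
Proof.
elim: k u => [|k IHk] u; first move=> [[|//] [_ <-] _].
  by rewrite big_nil big_seq big1 // => v vV; rewrite mulg1 vV.
move=> /shortS[->|[s [h [sS hk ->]]]].
  by rewrite big_seq big1 // => v vV; rewrite mulg1 vV.
pose F v := ((v * s)%g \in V) && ((v * s * h)%g \notin V).
apply: (@leq_trans (\sum_(v <- V) (v \in boundary S V) + \sum_(v <- V) F v)).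
  rewrite -big_split /= big_seq [X in _ <= X]big_seq; apply: leq_sum => v vV.
  rewrite /F mulgA; case: (boolP ((v * s)%g \in V)) => /= vsV; first exact: leq_addl.
  have -> : v \in boundary S V by apply/boundaryP; split=> //; exists s.
  by case: (_ \notin _).
rewrite mulSn leq_add //.
  rewrite -cardfs_sum; apply: fsubset_leq_card; apply/fsubsetP => v.
  by rewrite inE => /andP[].
apply: leq_trans (IHk h hk).
rewrite -!cardfs_sum; apply: (leq_cardfs_inj (@mulIg _ s)) => v.
by rewrite !inE => /andP[_ /andP[-> ->]].
Qed.

Lemma folner_setP n (V : {fset G}) : 0 < n ->
  folner_set S n V <-> V != fset0 /\ n * #|` boundary S V| <= #|` V|.
Proof.
move=> n0; rewrite /folner_set; split=> -[V0 bV]; split=> //; move: bV;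
rewrite ler_pdivrMr ?ltr0n ?cardfs_gt0 // mul1r ler_pdivlMl ?ltr0n //;
by rewrite -natrM ler_nat.
Qed.

Lemma folner_min n (V : {fset G}) : folner_set S n V ->
  folner S n <= #|` V| /\ exists2 W, folner_set S n W & #|` W| = folner S n.
Proof.
move=> nV; have VA : [set #|` W| | W in folner_set S n] #|` V| by exists V.
have [[W nW We] lb] := infimum_nat_min VA.
by split; [apply: lb; exists V | exists W].
Qed.

End Words.

(** * Transpositions and translations in the extension *)

Section Swap.
Variable H : Type.
Implicit Types x b c : H.

Definition swap_fun b c x : H :=
  if `[< x = b >] then c else if `[< x = c >] then b else x.

Lemma swap_funl b c : swap_fun b c b = c.
Proof. by rewrite /swap_fun; case: asboolP. Qed.

Lemma swap_funr b c : swap_fun b c c = b.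
Proof. by rewrite /swap_fun; case: asboolP => // _; case: asboolP. Qed.

Lemma swap_funn b c x : x <> b -> x <> c -> swap_fun b c x = x.
Proof. by rewrite /swap_fun; do 2!case: asboolP => //. Qed.

Lemma swap_funK b c : involutive (swap_fun b c).
Proof.
move=> x; have [->|xb] := pselect (x = b); first by rewrite swap_funl swap_funr.
have [->|xc] := pselect (x = c); first by rewrite swap_funr swap_funl.
by rewrite !swap_funn.
Qed.

Lemma swap_finite b c : finite_set [set x | swap_fun b c x <> x].
Proof.
apply: (@sub_finite_set _ _ ([set b] `|` [set c])%classic).
  move=> x /= sx; have [->|xb] := pselect (x = b); first by left.
  by have [->|xc] := pselect (x = c); [right | rewrite swap_funn in sx].
by rewrite finite_setU; split; exact: finite_set1.
Qed.

Definition swap b c : fsperm H :=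
  FSPerm (swap_funK b c) (swap_funK b c) (swap_finite b c).

Lemma swap_fun_inj (f : H -> H) b c x : injective f ->
  f (swap_fun b c x) = swap_fun (f b) (f c) (f x).
Proof.
move=> fi; have [->|xb] := pselect (x = b); first by rewrite !swap_funl.
have [->|xc] := pselect (x = c); first by rewrite !swap_funr.
by rewrite !swap_funn // => /fi.
Qed.

End Swap.

Section SymExt.
Variable N : groupType.
Local Notation G := (symext N).
Implicit Types (g h : N) (a : G).

(** The action of the extension on the underlying set of [N], in which the
normal subgroup permutes and [N] translates. *)
Definition symact a (x : N) : N := symext_perm a (symext_elt a * x)%g.

Lemma symactM a1 a2 x : symact (a1 * a2)%g x = symact a1 (symact a2 x).
Proof.
rewrite /symact /= /translate_fun; congr (symext_perm a1 (symext_elt a1 * _)%g).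
by rewrite mulgA mulgA mulVg mul1g.
Qed.

Lemma symact1 x : symact 1%g x = x.
Proof. by rewrite /symact /= mul1g. Qed.

Lemma symact_inj a : injective (symact a).
Proof.
by move=> x y /(can_inj (fsperm_funK (symext_perm a))); apply: mulgI.
Qed.

Lemma symext_ext a1 a2 : symext_elt a1 = symext_elt a2 ->
  symact a1 =1 symact a2 -> a1 = a2.
Proof.
case: a1 a2 => [s g] [s' h] /= <- e; congr SymExt; apply: fspermP => x.
by have := e (g^-1 * x)%g; rewrite /symact /= mulVKg.
Qed.

Definition symtrans g : G := SymExt 1%g g.

Definition symswap b c : G := SymExt (swap b c) 1%g.

Lemma symact_trans g x : symact (symtrans g) x = (g * x)%g.
Proof. by []. Qed.

Lemma symact_swap b c x : symact (symswap b c) x = swap_fun b c x.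
Proof. by rewrite /symact /= mul1g. Qed.

Lemma symtransM g h : symtrans (g * h)%g = (symtrans g * symtrans h)%g.
Proof. by apply: symext_ext => // x; rewrite symactM !symact_trans mulgA. Qed.

Lemma symtrans1 : symtrans 1%g = 1%g.
Proof. by []. Qed.

Lemma symtransV g : symtrans g^-1%g = (symtrans g)^-1%g.
Proof.
by apply: (@mulgI _ (symtrans g)); rewrite mulgV -symtransM mulgV symtrans1.
Qed.

Lemma symswapV b c : (symswap b c * symswap b c = 1)%g.
Proof.
apply: symext_ext => [|x]; first by rewrite /= mulg1.
by rewrite symactM !symact_swap symact1 swap_funK.
Qed.

Lemma symswap_id b : symswap b b = 1%g.
Proof.
apply: symext_ext => // x; rewrite symact_swap symact1.
by have [->|xb] := pselect (x = b); [rewrite swap_funl | rewrite swap_funn].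
Qed.

Lemma symswap_conj a b c :
  symswap (symact a b) (symact a c) = (a * symswap b c * a^-1)%g.
Proof.
apply: (@mulIg _ a); rewrite -mulgA mulVg mulg1.
apply: symext_ext => [|x]; first by rewrite /= mulg1 mul1g.
by rewrite !symactM !symact_swap (swap_fun_inj _ _ _ (@symact_inj a)).
Qed.

(** The conjugating element fixes [1] and moves [g] to [t * g], so the length of
[symswap 1 g] grows only by a constant when [g] is multiplied by a generator. *)
Lemma symswap1M t g : (t * g)%g <> 1%g -> g <> 1%g ->
  let a := (symswap 1%g t * symtrans t)%g in
  symswap 1%g (t * g)%g = (a * symswap 1%g g * a^-1)%g.
Proof.
move=> tg1 g1 a; rewrite -symswap_conj !symactM !symact_trans !symact_swap.
rewrite mulg1 swap_funr swap_funn // => e; apply: g1.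
by apply: (@mulgI _ t); rewrite mulg1.
Qed.

Section SwapLength.
Variables (S : {fset G}) (T : {fset N}) (L : nat).
Hypothesis symS : {in S, forall s, (s^-1)%g \in S}.
Hypothesis genT : symmetric_generating T.
Hypothesis swapL : forall t, t \in T -> short S L (symswap 1%g t).
Hypothesis transL : forall t, t \in T -> short S L (symtrans t).

Lemma short_symtrans n g : short T n g -> short S (n * L) (symtrans g).
Proof.
elim: n g => [|n IHn] g; first move=> [[|//] [_ <-] _].
  by rewrite big_nil symtrans1; apply: short1.
move=> /shortS[->|[t [h [tT hn ->]]]]; first by rewrite symtrans1; apply: short1.
by rewrite symtransM mulSn; apply: shortM; [exact: transL | exact: IHn].
Qed.

Lemma short_symswap1 n g : short T n g -> short S (n * (5 * L)) (symswap 1%g g).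
Proof.
elim: n g => [|n IHn] g; first move=> [[|//] [_ <-] _].
  by rewrite big_nil symswap_id; apply: short1.
move=> /shortS[->|[t [h [tT hn ->]]]]; first by rewrite symswap_id; apply: short1.
have [->|th1] := pselect ((t * h)%g = 1%g); first by rewrite symswap_id; apply: short1.
have [->|h1] := pselect (h = 1%g).
  rewrite mulg1; apply: short_leq (swapL tT); lia.
rewrite symswap1M //; set a := (_ * symtrans t)%g.
have aL : short S (L + L) a by apply: shortM; [exact: swapL | exact: transL].
have := shortM (shortM aL (IHn _ hn)) (shortV symS aL).
by apply: short_leq; lia.
Qed.

Lemma short_symswap n b c : short T n b -> short T n c ->
  short S (n * (12 * L)) (symswap b c).
Proof.
move=> bn cn.
have -> : symswap b c =
    (symtrans b * symswap 1 (b^-1 * c) * (symtrans b)^-1)%g.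
  by rewrite -symswap_conj !symact_trans mulg1 mulVKg.
have /short_symtrans bS := bn.
have := shortM (shortM bS (short_symswap1 (shortM (shortV genT.1 bn) cn)))
  (shortV symS bS).
by apply: short_leq; lia.
Qed.

End SwapLength.

(** A word of length [12 * L * n] represents each transposition of two points of
the ball of radius [n], so for a boundary ratio of [1 / (48 * L * n)] at most a
quarter of the pairs of a point and a transposition leave [V]. *)
Lemma folner_lower (S : {fset G}) (T : {fset N}) :
  symmetric_generating S -> symmetric_generating T ->
  exists K, 0 < K /\ forall n V, 0 < n -> folner_set S (K * n) V ->
    (growth T n %/ 8) ^ (growth T n %/ 16) <= #|` V|.
Proof.
move=> genS genT.
have [L0 swapL0] := short_ex_seq genS [seq symswap 1%g t | t <- T].
have [L1 transL1] := short_ex_seq genS [seq symtrans t | t <- T].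
pose L := (L0 + L1).+1.
have swapL t : t \in T -> short S L (symswap 1%g t).
  move=> tT; apply: (@short_leq _ _ L0); first by rewrite /L; lia.
  exact/swapL0/map_f.
have transL t : t \in T -> short S L (symtrans t).
  move=> tT; apply: (@short_leq _ _ L1); first by rewrite /L; lia.
  exact/transL1/map_f.
exists (4 * (12 * L)); split=> // n V n0 /folner_setP[|V0 bV]; first by lia.
rewrite growthE; set B := word_ball T n.
set m := #|` B|.
have m0 : 0 < m.
  by rewrite cardfs_gt0; apply/fset0Pn; exists 1%g; apply/word_ballP => //; apply: short1.
have leak : \sum_(v <- V) \sum_(b <- B) \sum_(c <- B)
    ((v * symswap b c)%g \notin V) <= m * (m * (n * (12 * L) * #|` boundary S V|)).
  rewrite exchange_big /=; apply: sum_leq_size => b /(word_ballP genT) bB.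
  rewrite exchange_big /=; apply: sum_leq_size => c /(word_ballP genT) cB.
  by apply: leak_leq => //; exact: (short_symswap genS.1 genT swapL transL).
have total : \sum_(v <- V) swap_degree symswap V B v +
    \sum_(v <- V) \sum_(b <- B) \sum_(c <- B) ((v * symswap b c)%g \notin V) =
    #|` V| * (m * m).
  rewrite -big_split /= -sum_const_seq; apply: eq_bigr => v _.
  rewrite -big_split /= -sum_const_seq; apply: eq_bigr => b _.
  rewrite -big_split /= -[RHS]muln1 -sum_const_seq; apply: eq_bigr => c _.
  by case: (_ \in V).
have V1 : 0 < #|` V| by rewrite cardfs_gt0.
have [||Y [YV Y0 YD]] := @swap_degree_dense _ _ symswap _ (m * m %/ 2) B V.
- exact: symswapV.
- move: leak total bV; set e := \sum_(v <- V) swap_degree _ _ _ _; set l := \sum_(v <- V) _.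
  move=> leak total bV; have half : m * m %/ 2 * 2 <= m * m by apply: leq_divM.
  have mm0 : 0 < m * m by rewrite muln_gt0 m0.
  have l4 : 4 * l <= #|` V| * (m * m).
    apply: leq_trans (leq_mul (leqnn 4) leak) _.
    rewrite [leqLHS](_ : _ = 4 * (12 * L) * n * #|` boundary S V| * (m * m)); last by lia.
    by rewrite leq_mul2r bV orbT.
  have h2 : m * m %/ 2 * 2 * #|` V| <= m * m * #|` V| by rewrite leq_mul2r half orbT.
  have Vmm : 0 < #|` V| * (m * m) by rewrite muln_gt0 V1.
  lia.
apply: leq_trans (fsubset_leq_card YV).
apply: (@swap_degree_card _ _ symact symswap _ _ _ _ (m %/ 8) (m %/ 16) m Y B) => //.
- exact: symactM.
- exact: symact_inj.
- by move=> b c; rewrite symact_swap swap_funl.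
- by move=> b c x /eqP xb /eqP xc; rewrite symact_swap swap_funn.
move=> w /YD mw.
have mm : m * (4 * (m %/ 8 + 2 * (m %/ 16))) <= m * m.
  by rewrite leq_mul2l; apply/orP; right; lia.
move: mw mm; move: (swap_degree _ _ _ _) (m %/ 8 + _) => e q.
rewrite mulnCA; move: (m * m) (m * q) => M Q; lia.
Qed.

End SymExt.

(** * Generation by translations and transpositions *)

Lemma cardfsM (K L : choiceType) (A : {fset K}) (B : {fset L}) :
  #|` (A `*` B)%fset| = #|` A| * #|` B|.
Proof.
rewrite -(size_allpairs pair); apply: perm_size; apply: uniq_perm.
- exact: fset_uniq.
- by apply: allpairs_uniq; rewrite ?fset_uniq // => -[? ?] [].
move=> [x y]; rewrite in_fsetM /=; apply/andP/allpairsP => [[xA yB]|].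
  by exists (x, y).
by move=> [[x' y'] [/= ? ? [-> ->]]].
Qed.

Section Generation.
Variable N : groupType.
Variable T : {fset N}.
Hypothesis genT : symmetric_generating T.

(** Composing [s] with the transposition of [x] and [s x] makes it fix [x], and
creates no new moved point. *)
Lemma short_finite_support (S : {fset symext N}) (E : {fset N}) (s : fsperm N) :
  (forall b c, exists k, short S k (symswap b c)) ->
  (forall x, x \notin E -> s x = x) ->
  exists k, short S k (SymExt s 1%g).
Proof.
move=> swapS; have [n] := ubnP #|` E|; elim: n E s => // n IHn E s En sE.
have [E0|[x xE]] := fset_0Vmem E.
  exists 0; have -> : s = 1%g by apply: fspermP => x; rewrite sE // E0 inE.
  exact: short1.
have [||k sk] := IHn (E `\ x) (swap x (s x) * s)%g.
- by rewrite (cardfsD1 x) xE in En.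
- move=> y; rewrite !inE negb_and negbK /= => yE.
  have [->|/eqP yx] := pselect (y = x); first by rewrite swap_funr.
  have {}yE : y \notin E by case/orP: yE => // /eqP yx'; rewrite yx' eqxx in yx.
  rewrite (sE y) // swap_funn => // [/eqP|e]; first exact: negP.
  by move: yx; rewrite -(can_inj (fsperm_funK s) (etrans (sE y yE) e)) eqxx.
have [l wl] := swapS x (s x); exists (l + k).
have -> : SymExt s 1%g = (symswap x (s x) * SymExt (swap x (s x) * s) 1)%g.
  apply: symext_ext => [|y]; first by rewrite /= mulg1.
  by rewrite symactM symact_swap /symact /= mul1g swap_funK.
exact: shortM.
Qed.

Lemma symext_generating : exists S : {fset symext N}, symmetric_generating S.
Proof.
pose S : {fset symext N} := [fset symtrans t | t in T] `|` [fset symswap 1%g t | t in T].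
have swapS t : t \in T -> short S 1 (symswap 1%g t).
  by move=> tT; apply: short_gen; rewrite inE; apply/orP; right; apply/imfsetP; exists t.
have transS t : t \in T -> short S 1 (symtrans t).
  by move=> tT; apply: short_gen; rewrite inE; apply/orP; left; apply/imfsetP; exists t.
have symS : {in S, forall s, (s^-1)%g \in S}.
  move=> s; rewrite inE => /orP[] /imfsetP[t /= tT ->].
    rewrite inE; apply/orP; left; apply/imfsetP; exists (t^-1)%g => /=.
      exact: genT.1.
    by rewrite symtransV.
  rewrite inE; apply/orP; right; apply/imfsetP; exists t => //=.
  by apply: (@mulgI _ (symswap 1%g t)); rewrite mulgV symswapV.
exists S; split => // -[s g].
have [k sk] : exists k, short S k (SymExt s 1%g).
  apply: (@short_finite_support _ (fset_set [set x | s x <> x])).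
    move=> b c; have [k [bk ck]] : exists k, short T k b /\ short T k c.
      have [i ib] := short_ex genT b; have [j jc] := short_ex genT c.
      exists (i + j); split; first exact: short_leq (leq_addr _ _) ib.
      exact: short_leq (leq_addl _ _) jc.
    by exists (k * (12 * 1)); apply: (short_symswap symS genT swapS transS).
  move=> x; rewrite in_fset_set ?notin_setE /=; last exact: fsperm_finite_support.
  by move=> /contrapT.
have [l gl] := short_ex genT g.
have [w gw _] : short S (k + l * 1) (SymExt s g).
  have -> : SymExt s g = (SymExt s 1 * symtrans g)%g.
    apply: symext_ext => [|x]; first by rewrite /= mul1g.
    by rewrite symactM symact_trans /symact /= mul1g.
  by apply: shortM => //; apply: (short_symtrans transS).
by exists w.
Qed.

End Generation.

(** * Foelner sets from balls *)

Section FolnerSets.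
Variable N : groupType.

(** A permutation supported in [E] preserves [E] and is determined by the self-map
that it induces there.  The count of all self-maps, rather than of the
permutations of [E], is precise enough for the asymptotics. *)
Lemma finite_fsperm_on (E : {fset N}) : exists P : {fset fsperm N},
  (forall s, s \in P <-> (forall x, x \notin E -> s x = x)) /\
  #|` P| <= #|` E| ^ #|` E|.
Proof.
(* At most one permutation induces f. *)
pose D (f : {ffun E -> E}) := [set s : fsperm N |
  (forall x, x \notin E -> s x = x) /\ forall x : E, s (val x) = val (f x)].
pose decode f := xget 1%g (D f).
pose P : {fset fsperm N} := [fset decode f | f : {ffun E -> E}].
exists [fset s in P | `[< forall x, x \notin E -> s x = x >]]; split=> [s|].
  rewrite !inE; split=> [/andP[_ /asboolP]//|sE].
  apply/andP; split; last exact/asboolP.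
  have sEE (x : E) : s (val x) \in E.
    apply/negPn/negP => sx; have := sE _ sx => /(can_inj (fsperm_funK s)) e.
    by rewrite e (valP x) in sx.
  apply/imfsetP; exists [ffun x => [` sEE x]] => //=.
  apply/esym/xget_unique => [|u [uE u_eq]].
    by split=> // x; rewrite ffunE.
  apply: fspermP => x; case: (boolP (x \in E)) => xE; last by rewrite uE ?sE.
  by have := u_eq [` xE]; rewrite ffunE.
apply: (@leq_trans #|` P|).
  by apply: fsubset_leq_card; apply/fsubsetP => s; rewrite inE => /andP[].
apply: leq_trans (leq_imfset_card _ _ _) _.
have -> : #|` E| ^ #|` E| = #|{ffun E -> E}| by rewrite card_ffun cardfE.
by rewrite cardE.
Qed.

Lemma leq_selfexp m n : m <= n -> 0 < n -> m ^ m <= n ^ n.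
Proof.
move=> mn n0; apply: (@leq_trans (n ^ m)); first by case: m mn => // m mn; rewrite leq_exp2r.
by rewrite leq_pexp2l.
Qed.

Lemma finite_supports (S : {fset symext N}) : exists A : {fset N},
  forall s, s \in S -> forall x, x \notin A -> symext_perm s x = x.
Proof.
exists (\bigcup_(s <- S) fset_set [set x | symext_perm s x <> x])%fset => s sS x.
move=> /bigfcupP xA; apply: contrapT => sx; apply: xA; exists s; first by rewrite sS.
rewrite in_fset_set; first exact/mem_set.
exact: fsperm_finite_support.
Qed.

(** Right multiplication of [(s, g)] by a generator [a] changes [s] only inside
[g A], which is contained in [E = F A] when [g] is in [F].  Hence [(s, g)] can
leave the set only when [g] leaves the ball [F], which requires [g] to be outside
of the ball whose radius is smaller by the length of the [N]-part of [a]. *)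
Lemma folner_upper (S : {fset symext N}) (T : {fset N}) :
  symmetric_generating S -> symmetric_generating T ->
  exists A c, [/\ 0 < A, 0 < c & forall n r, 0 < n -> c <= r ->
    n * growth T r <= growth T r + n * growth T (r - c) ->
    exists V, folner_set S n V /\
      #|` V| <= growth T r * (A * growth T r) ^ (A * growth T r)].
Proof.
move=> genS genT; have [A SA] := finite_supports S.
have [c0 Sc] := short_ex_seq genT [seq symext_elt s | s <- S].
exists (#|` A|.+1), c0.+1; split=> // n r n0 cr nr.
pose F := word_ball T r; pose F' := word_ball T (r - c0.+1).
pose E := [fset (g * a)%g | g in F, a in A].
have [P [PE Pcard]] := finite_fsperm_on E.
pose V := [fset SymExt p.1 p.2 | p in P `*` F].
have VE s g : (SymExt s g \in V) = (s \in P) && (g \in F).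
  apply/imfsetP/andP => [[[s' g'] /=]|[sP gF]].
    by rewrite in_fsetM /= => /andP[? ?] [-> ->].
  by exists (s, g) => //=; rewrite in_fsetM sP gF.
have Vcard : #|` V| = #|` P| * growth T r.
  by rewrite card_imfset /= ?cardfsM // => -[? ?] [? ?] /= [-> ->].
have P1 : 1%g \in P by apply/PE.
have F1 : 1%g \in F by apply/word_ballP => //; exact: short1.
have r0 : 0 < growth T r by rewrite growthE cardfs_gt0; apply/fset0Pn; exists 1%g.
exists V; split; last first.
  rewrite Vcard mulnC leq_mul2l; apply/orP; right; apply: leq_trans Pcard _.
  apply: leq_selfexp; last by rewrite muln_gt0.
  apply: (@leq_trans (growth T r * #|` A|)); last by rewrite mulnC leq_mul2r leqnSn orbT.
  have -> : E = [fset (p.1 * p.2)%g | p in F `*` A].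
    apply/fsetP => x; apply/imfset2P/imfsetP => [[g gF [a aA ->]]|[[g a] /=]].
      by exists (g, a) => //=; rewrite in_fsetM; apply/andP.
    by rewrite in_fsetM => /andP[gF aA] ->; exists g => //; exists a.
  by apply: leq_trans (leq_imfset_card _ _ _) _; rewrite /= cardfsM.
apply/folner_setP => //; split; first by apply/fset0Pn; exists (SymExt 1%g 1%g); rewrite VE P1.
have FF' : F' `<=` F.
  apply/fsubsetP => g /(word_ballP genT) gF; apply/(word_ballP genT).
  exact: short_leq (leq_subr _ _) gF.
have bV : #|` boundary S V| <= #|` P| * (growth T r - growth T (r - c0.+1)).
  rewrite !growthE -cardfsDS // -cardfsM.
  apply: (@leq_cardfs_inj _ _ (fun a : symext N => (symext_perm a, symext_elt a))).
    by move=> [? ?] [? ?] /= [-> ->].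
  move=> [s g] /(boundaryP genS)[]; rewrite VE => /andP[sP gF] [a aS].
  rewrite in_fsetM /= sP inE gF andbT /=.
  apply: contraNN => /(word_ballP genT) gF'.
  rewrite VE; apply/andP; split.
    apply/PE => x xE /=; rewrite /translate_fun (SA a) //.
      by rewrite mulVKg; exact: (PE s).1 sP x xE.
    apply: contraNN xE => xA; apply/imfset2P; exists g => //.
    by exists (g^-1 * x)%g => //; rewrite mulVKg.
  apply/(word_ballP genT) => /=.
  have := shortM gF' (Sc _ (map_f _ aS)); apply: short_leq; lia.
apply: leq_trans (leq_mul (leqnn n) bV) _.
rewrite Vcard mulnCA leq_mul2l mulnBr; apply/orP; right; lia.
Qed.

End FolnerSets.

(** * Slow growth at some radius *)

Lemma exp_beats_poly C K d : exists i, C * (K + i) ^ d < 2 ^ i.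
Proof.
pose u := (2 * d + C + K).+1.
exists (2 ^ (2 * u)).
have lt2 (m : nat) : m < 2 ^ m by exact: ltn_expl.
have Kle : K <= 2 ^ (2 * u) by apply: leq_trans (ltnW (lt2 _)); rewrite /u; lia.
have base : K + 2 ^ (2 * u) <= 2 ^ (2 * u).+1 by rewrite expnS; lia.
apply: (@leq_ltn_trans (2 ^ C * (2 ^ (2 * u).+1) ^ d)).
  by apply: leq_mul; [exact: ltnW | case: (d) => // d'; rewrite leq_exp2r].
rewrite -expnM -expnD ltn_exp2l //.
have -> : 2 ^ (2 * u) = 2 ^ u * 2 ^ u by rewrite mul2n -addnn expnD.
have u2 := lt2 u; apply: (@leq_trans (u.+1 * u.+1)).
  by rewrite /u; nia.
exact: leq_mul.
Qed.

Section Doubling.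
Variables (v : nat -> nat) (C K C' K' d c : nat).
Hypothesis v_leq : forall m n, m <= n -> v m <= v n.
Hypothesis v_upper : forall x, 0 < x -> v x <= C * (K * x) ^ d.
Hypothesis v_lower : forall x, 0 < x -> x ^ d <= C' * v (K' * x).
Hypotheses (c0 : 0 < c) (K'0 : 0 < K').

(** Otherwise [v] at least doubles over every [n] consecutive steps of length [c],
by Bernoulli's inequality for the factor [1 + 1 / n].  From radius [K' * n * c] to
[(K' + i) * n * c] it would be multiplied by [2 ^ i], while the polynomial bounds
allow a factor that is polynomial in [i] and does not depend on [n]. *)
Lemma slow_radius : exists R, 0 < R /\ forall n, 0 < n ->
  exists r, [/\ c <= r, r <= R * n & n * v r <= v r + n * v (r - c)].
Proof.
have [i ilarge] := exp_beats_poly (C' * C * K ^ d) K' d.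
exists (c * (K' + i)).+1; split=> // n n0; apply: contrapT => noR.
have step r : c <= r -> r <= c * (K' + i) * n -> v r + n * v (r - c) < n * v r.
  move=> cr rR; rewrite ltnNge; apply/negP => nr; apply: noR; exists r; split=> //.
  by apply: leq_trans rR _; rewrite leq_mul2r leqnSn orbT.
have double p : p + n <= (K' + i) * n -> 2 * v (p * c) <= v ((p + n) * c).
  move=> pn; suff inner j : j <= n -> (n + j) * v (p * c) <= n * v ((p + j) * c).
    by have := inner n (leqnn n); rewrite addnn -mul2n mulnAC mulnC leq_pmul2l // mulnC.
  elim: j => [|j IHj] jn; first by rewrite !addn0.
  have := step ((p + j.+1) * c); rewrite addnS mulSn leq_addr addKn => /(_ isT).
  have rR : c + (p + j) * c <= c * (K' + i) * n.
    by rewrite -mulnA [leqRHS]mulnC -mulSn leq_mul2r; apply/orP; right; lia.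
  move=> /(_ rR) stp; apply: leq_trans (ltnW stp).
  rewrite addnS mulSn leq_add //; last by apply: IHj; exact: ltnW.
  by apply: v_leq; rewrite (leq_trans _ (leq_addl _ _)) // leq_mul2r leq_addr orbT.
have iter j : j <= i -> 2 ^ j * v (K' * n * c) <= v ((K' + j) * n * c).
  elim: j => [|j IHj] ji; first by rewrite expn0 mul1n addn0.
  rewrite addnS [(K' + j).+1 * n]mulSnr expnS -mulnA.
  apply: (@leq_trans (2 * v ((K' + j) * n * c))).
    by rewrite leq_mul2l IHj // ltnW.
  by apply: double; rewrite -mulSnr -addnS leq_mul2r leq_add2l ji orbT.
have nc0 : 0 < n * c by rewrite muln_gt0 n0.
have ncd0 : 0 < (n * c) ^ d by rewrite expn_gt0 nc0.
have up : v ((K' + i) * n * c) <= C * (K ^ d * ((K' + i) ^ d * (n * c) ^ d)).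
  by rewrite -!expnMn [(K' + i) * (n * c)]mulnA v_upper // !muln_gt0 addn_gt0 K'0 n0.
have low : (n * c) ^ d <= C' * v (K' * n * c) by rewrite -mulnA v_lower.
have ge : 2 ^ i * (n * c) ^ d <= C' * C * K ^ d * (K' + i) ^ d * (n * c) ^ d.
  apply: leq_trans (leq_mul (leqnn _) low) _; rewrite mulnCA.
  rewrite [leqRHS](_ : _ = C' * (C * (K ^ d * ((K' + i) ^ d * (n * c) ^ d)))); last by rewrite !mulnA.
  by rewrite leq_mul2l (leq_trans (iter i (leqnn i)) up) orbT.
by move: ge; rewrite leq_pmul2r // leqNgt ilarge.
Qed.

End Doubling.

(** * Groups of polynomial growth *)

Section PolynomialGrowth.
Variables (N : groupType) (T : {fset N}) (d : nat).
Hypotheses (genT : symmetric_generating T) (d0 : 0 < d).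
Hypothesis growthT : asymp_equiv (growth T) (fun n => n ^ d).

Lemma folner_set_bounded (S : {fset symext N}) : symmetric_generating S ->
  exists K, 0 < K /\ forall n, 0 < n ->
    exists V, folner_set S n V /\ #|` V| <= (K * n) ^ ((K * n) ^ d).
Proof.
move=> genS; have [A [c [A0 c0 upper]]] := folner_upper genS genT.
have [[C [K [C0 K0 v_up]]] [C' [K' [_ K'0 v_low]]]] := growthT.
have [R [R0 slow]] := slow_radius (growth_leq genT) v_up v_low c0 K'0.
have [M M0 ME] : exists2 M, 0 < M & M = A * (C * (K * R) ^ d).
  by exists (A * (C * (K * R) ^ d)); rewrite // !muln_gt0 A0 C0 expn_gt0 muln_gt0 K0 R0.
exists (2 * d * M); split=> [|n n0]; first by rewrite !muln_gt0 d0 M0.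
have [r [cr rR vr]] := slow n n0.
have [V [FV Vcard]] := upper n r n0 cr vr; exists V; split=> //.
have vA : A * growth T r <= M * n ^ d.
  rewrite ME -!mulnA leq_mul2l -expnMn -mulnA; apply/orP; right.
  by apply: leq_trans (growth_leq genT rR) (v_up _ _); rewrite muln_gt0 R0.
have Mn0 : 0 < M * n ^ d by rewrite muln_gt0 M0 expn_gt0 n0.
apply: leq_trans Vcard _.
apply: (@leq_trans ((M * n ^ d) * (M * n ^ d) ^ (M * n ^ d))).
  apply: leq_mul; last exact: leq_selfexp.
  by apply: leq_trans vA; rewrite leq_pmull.
rewrite -expnS; apply: (@leq_trans ((M * n ^ d) ^ (2 * (M * n ^ d)))).
  by rewrite leq_pexp2l //; lia.
apply: (@leq_trans (((M * n) ^ d) ^ (2 * (M * n ^ d)))).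
  rewrite leq_exp2r; last by rewrite muln_gt0 Mn0.
  by rewrite expnMn leq_mul2r -{1}(expn1 M) leq_pexp2l // orbT.
have Q1 : M * n <= 2 * d * M * n by rewrite leq_mul2r leq_pmull ?orbT // muln_gt0 d0.
rewrite -expnM; apply: (@leq_trans ((2 * d * M * n) ^ (d * (2 * (M * n ^ d))))).
  by rewrite leq_exp2r // muln_gt0 d0 muln_gt0 Mn0.
have QM : 2 * d * M <= (2 * d * M) ^ d.
  by rewrite -{1}(expn1 (2 * d * M)) leq_pexp2l // !muln_gt0 d0 M0.
apply: leq_pexp2l; first by rewrite !muln_gt0 d0 M0.
rewrite [leqRHS]expnMn; apply: leq_trans (leq_mul QM (leqnn _)).
by rewrite !mulnA [d * 2]mulnC.
Qed.

(** The growth at radius [K' * 16 * C' * n] is at least [16 * n ^ d], which makes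
both the base and the exponent provided by [folner_lower] large enough. *)
Lemma folner_set_large (S : {fset symext N}) : symmetric_generating S ->
  exists K, 0 < K /\ forall n V, 0 < n -> folner_set S (K * n) V ->
    n ^ (n ^ d) <= #|` V|.
Proof.
move=> genS; have [K0 [K0_gt0 lower]] := folner_lower genS genT.
have [_ [C' [K' [C'0 K'0 v_low]]]] := growthT.
have [s s0 sE] : exists2 s, 0 < s & s = 16 * C'.
  by exists (16 * C'); rewrite // muln_gt0.
exists (K0 * (K' * s)); split=> [|n V n0]; first by rewrite !muln_gt0 K0_gt0 K'0.
rewrite -!mulnA => /lower; rewrite !muln_gt0 K'0 s0 n0 => /(_ isT); apply: leq_trans.
have sn0 : 0 < s * n by rewrite muln_gt0 s0.
have v16 : 16 * n ^ d <= growth T (K' * (s * n)).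
  rewrite -(leq_pmul2l C'0); apply: leq_trans (v_low _ sn0).
  rewrite expnMn mulnA leq_mul2r [C' * 16]mulnC -sE; apply/orP; right.
  by rewrite -{1}(expn1 s) leq_pexp2l.
have nd : n <= n ^ d by rewrite -{1}(expn1 n) leq_pexp2l.
set v := growth _ _ in v16 *.
have n8 : n <= v %/ 8 by lia.
apply: (@leq_trans (n ^ (v %/ 16))); first by rewrite leq_pexp2l //; lia.
by rewrite leq_exp2r //; have := expn_gt0 n d; rewrite n0; lia.
Qed.

Lemma folner_asymp_symext : folner_asymp (symext N) (fun n => n ^ (n ^ d)).
Proof.
split=> [|S genS]; first exact: symext_generating genT.
have [K [K0 upper]] := folner_set_bounded genS; split.
  exists 1, K; split=> // n n0; have [V [FV Vcard]] := upper n n0.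
  by rewrite mul1n; apply: leq_trans Vcard; have [] := folner_min FV.
have [L [L0 lower]] := folner_set_large genS.
exists 1, L; split=> // n n0; rewrite mul1n.
have [|V [FV _]] := upper (L * n); first by rewrite muln_gt0 L0.
by have [_ [W FW <-]] := folner_min FV; exact: lower FW.
Qed.

End PolynomialGrowth.

(** * The groups Z^d *)

Section Lattice.
Variables (N : groupType) (d : nat).
(** Stating the coordinates abstractly covers the integers, which are not row
vectors of size one, along with the row vectors. *)
Variables (coord : N -> 'I_d -> int) (point : ('I_d -> int) -> N).
Hypothesis pointK : forall f i, coord (point f) i = f i.
Hypothesis coordK : forall g, point (coord g) = g.
Hypothesis coordM : forall g h i, coord (g * h)%g i = (coord g i + coord h i)%R.

Lemma coord1 i : coord 1%g i = 0%R.
Proof. by have := coordM 1%g 1%g i; rewrite mulg1; lia. Qed.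

Lemma coordV g i : coord g^-1%g i = (- coord g i)%R.
Proof. by have := coordM g g^-1%g i; rewrite mulgV coord1; lia. Qed.

Lemma coord_inj g h : (forall i, coord g i = coord h i) -> g = h.
Proof. by move=> /funext e; rewrite -[g]coordK e coordK. Qed.

Definition in_cube k g := forall i, (`|coord g i| <= k)%N.

Definition cube_point k (f : {ffun 'I_d -> 'I_(2 * k).+1}) : N :=
  point (fun i => (f i : nat)%:Z - k%:Z)%R.

Definition cube k : {fset N} :=
  [fset cube_point f | f : {ffun 'I_d -> 'I_(2 * k).+1}].

Lemma cubeP k g : g \in cube k <-> in_cube k g.
Proof.
split=> [/imfsetP[f _ ->] i|gk].
  rewrite pointK; have := ltn_ord (f i).
  move: (f i : nat) => a; lia.
have bound i : `|(coord g i + k%:Z)%R|%N < (2 * k).+1 by have := gk i; lia.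
apply/imfsetP; exists [ffun i => Ordinal (bound i)] => //=.
by apply: coord_inj => i; rewrite pointK ffunE /=; have := gk i; lia.
Qed.

Lemma card_cube k : #|` cube k| = (2 * k).+1 ^ d.
Proof.
rewrite card_imfset /=; last first.
  move=> f g e; apply/ffunP => i; apply: val_inj => /=.
  by have := congr1 (fun h => coord h i) e; rewrite !pointK; lia.
have -> : (2 * k).+1 ^ d = #|{ffun 'I_d -> 'I_(2 * k).+1}|.
  by rewrite card_ffun !card_ord.
by rewrite cardE.
Qed.

(** Moving every nonzero coordinate by one towards [0] at the same time is a single
step for the generating set [cube 1], so balls are exactly cubes. *)
Lemma short_cube k g : short (cube 1) k g <-> in_cube k g.
Proof.
elim: k g => [|k IHk] g; split.
- move=> [[|//] [_ <-] _] i; by rewrite big_nil coord1.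
- move=> gk; have -> : g = 1%g.
    by apply: coord_inj => i; rewrite coord1; have := gk i; lia.
  exact: short1.
- move=> /shortS[-> i|[s [h [/cubeP s1 /IHk hk ->]]] i]; first by rewrite coord1.
  by rewrite coordM; have := s1 i; have := hk i; lia.
move=> gk; pose s := point (fun i => if (0 < coord g i)%R then 1%R else
  if (coord g i < 0)%R then (- 1)%R else 0%R).
rewrite -[g](mulVKg s) -[k.+1]add1n; apply: shortM.
  apply: short_gen; apply/cubeP => i; rewrite pointK; case: ifP => _ //.
  by case: ifP.
apply/IHk => i; rewrite coordM coordV pointK; have := gk i.
by case: ifP => ?; [lia | case: ifP; lia].
Qed.

Lemma generating_cube : symmetric_generating (cube 1).
Proof.
split=> [s|g].
  by move=> /cubeP s1; apply/cubeP => i; rewrite coordV; have := s1 i; lia.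
have /short_cube[w gw _] : in_cube (\max_i `|coord g i|%N) g.
  by move=> i; exact: (leq_bigmax_cond (F := fun i => `|coord g i|%N)).
by exists w.
Qed.

Lemma growth_cube n : growth (cube 1) n = (2 * n).+1 ^ d.
Proof.
rewrite growthE -card_cube; congr size; congr enum_fset; apply/fsetP => g.
apply/idP/idP => [/(word_ballP generating_cube)/short_cube|] gn; first exact/cubeP.
by apply/(word_ballP generating_cube)/short_cube/cubeP.
Qed.

Lemma growth_cube_asymp : asymp_equiv (growth (cube 1)) (fun n => n ^ d).
Proof.
split; exists 1.
  exists 3; split=> // n n0; rewrite growth_cube mul1n.
  by case: (d) => // d'; rewrite leq_exp2r //; lia.
exists 1; split=> // n n0; rewrite growth_cube !mul1n.
by case: (d) => // d'; rewrite leq_exp2r //; lia.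
Qed.

Lemma folner_asymp_lattice : 0 < d ->
  folner_asymp (symext N) (fun n => n ^ (n ^ d)).
Proof.
by move=> d0; exact: folner_asymp_symext generating_cube d0 growth_cube_asymp.
Qed.

End Lattice.

Theorem mainTheorem5 :
  folner_asymp (symext (Algebra.to_multiplicative int)) (fun n => n ^ n)%N /\
  (forall d : nat, (1 <= d)%N ->
     folner_asymp (symext (Algebra.to_multiplicative 'rV[int]_d))
       (fun n => n ^ (n ^ d))%N /\
     (forall (N : groupType) (T : {fset N}),
        symmetric_generating T ->
        asymp_equiv (growth T) (fun n => n ^ d)%N ->
        folner_asymp (symext N) (fun n => n ^ (n ^ d))%N)).
Proof.
split.
  pose coord (z : Algebra.to_multiplicative int) (_ : 'I_1) : int := z.
  pose point (f : 'I_1 -> int) : Algebra.to_multiplicative int := f ord0.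
  have pointK f i : coord (point f) i = f i by rewrite (ord1 i).
  have coordK g : point (coord g) = g by [].
  have coordM g h i : coord (g * h)%g i = (coord g i + coord h i)%R by [].
  rewrite (_ : (fun n => n ^ n) = (fun n => n ^ (n ^ 1))); last first.
    by apply: funext => n; rewrite expn1.
  exact: folner_asymp_lattice pointK coordK coordM isT.
move=> d d1; split=> [|N T genT growthT]; last exact: folner_asymp_symext growthT.
pose coord (z : Algebra.to_multiplicative 'rV[int]_d) (i : 'I_d) : int :=
  (z : 'rV_d) ord0 i.
pose point (f : 'I_d -> int) : Algebra.to_multiplicative 'rV[int]_d :=
  (\row_i f i)%R.
have pointK f i : coord (point f) i = f i by rewrite /coord mxE.
have coordK g : point (coord g) = g by apply/rowP => i; rewrite mxE.
have coordM g h i : coord (g * h)%g i = (coord g i + coord h i)%R.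
  by rewrite /coord mxE.
exact: folner_asymp_lattice pointK coordK coordM d1.
Qed.
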